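(* Let $\mathsf{K}$ be a class of intuitionistic monotone frames (IM-frames) that is closed under $\sigma$-prime filter extensions. Then $\mathsf{K}$ is axiomatic if and only if it reflects $\sigma$-prime filter extensions and is closed under disjoint unions, generated subframes and p-morphic images.
   Context: An IM-frame is $(X,\le,N)$ with $(X,\le)$ a poset and $N$ assigning to each $x$ a set $N(x)$ of upsets of $(X,\le)$ that is upward closed under inclusion among upsets, with $x\le y$ implying $N(x)\subseteq N(y)$. An IMF-morphism $f:(X_1,\le_1,N_1)\to(X_2,\le_2,N_2)$ is a p-morphism (order-preserving, and $f(x)\le_2 y'$ implies some $y\ge_1 x$ has $f(y)=y'$) with $f^{-1}(a)\in N_1(x)$ iff $a\in N_2(f(x))$ for all $x$ and upsets $a$ of $X_2$. The language is intuitionistic propositional logic plus a unary $\triangle$; valuations assign upsets to proposition letters, connectives are interpreted intuitionistically, and $x\Vdash\triangle\phi$ iff $[\![\phi]\!]\in N(x)$. $\mathsf{K}$ is axiomatic if it is the class of IM-frames validating (truth everywhere under all valuations) some set of formulas. Disjoint union of $(X_k,\le_k,N_k)$: disjoint union of posets with $a\in N(x)$ iff $a\cap X_k\in N_k(x)$ for $x\in X_k$. Generated subframe: domain of an IMF-morphism that is an order-embedding; p-morphic image: codomain of a surjective IMF-morphism. The $\sigma$-prime filter extension of $(X,\le,N)$ is $(X^{pe},\subseteq,N^{\sigma})$ where $X^{pe}$ is the set of prime filters of the lattice of upsets of $(X,\le)$; with $\theta(a)=\{\mathfrak{q}\in X^{pe}\mid a\in\mathfrak{q}\}$ and $\triangle_N(a)=\{x\mid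 a\in N(x)\}$, call an upset $D$ of $X^{pe}$ open if $D=\bigcup\{\theta(a)\mid\theta(a)\subseteq D\}$; for open $D$, $D\in N^\sigma(\mathfrak{q})$ iff there is an upset $a$ of $X$ with $\triangle_N(a)\in\mathfrak{q}$ and $\theta(a)\subseteq D$; for any other upset $D$, $D\in N^\sigma(\mathfrak{q})$ iff every open upset containing $D$ is in $N^\sigma(\mathfrak{q})$. Closure under (reflection of) $\sigma$-prime filter extensions: $\mathcal{X}\in\mathsf{K}\Rightarrow\mathcal{X}^{pe}\in\mathsf{K}$ (resp. the converse). *)

(* Defs.v *)
From Stdlib Require Relation_Definitions.
From mathcomp Require Import all_boot.
From mathcomp Require Import boolp classical_sets.

Set Implicit Arguments.
Unset Strict Implicit.
Unset Printing Implicit Defensive.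

Local Open Scope classical_set_scope.

Definition upset (T : Type) (R : T -> T -> Prop) (a : set T) : Prop :=
  forall x y, R x y -> a x -> a y.

(* [nbhd x] ranges over all sets of points; [nbhd_upset] makes it a set of
   upsets. The carrier may be empty. *)
Record IMFrame : Type := MkIMFrame {
  carrier :> Type;
  fle : carrier -> carrier -> Prop;
  nbhd : carrier -> set (set carrier);
  fle_order : Relation_Definitions.order carrier fle;
  nbhd_upset : forall x a, nbhd x a -> upset fle a;
  nbhd_up : forall x a b, nbhd x a -> upset fle b -> a `<=` b -> nbhd x b;
  nbhd_le : forall x y, fle x y -> nbhd x `<=` nbhd y
}.

Arguments fle {_} _ _.
Arguments nbhd {_} _ _.

Definition p_morphism (X Y : IMFrame) (f : X -> Y) : Prop :=
  (forall x y, fle x y -> fle (f x) (f y)) /\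
  (forall x y', fle (f x) y' -> exists y, fle x y /\ f y = y').

Definition IMF_morphism (X Y : IMFrame) (f : X -> Y) : Prop :=
  p_morphism f /\
  (forall x a, upset fle a -> (nbhd x (f @^-1` a) <-> nbhd (f x) a)).

Definition order_embedding (X Y : IMFrame) (f : X -> Y) : Prop :=
  forall x y, fle x y <-> fle (f x) (f y).

Definition generated_subframe (X Y : IMFrame) : Prop :=
  exists f : X -> Y, IMF_morphism f /\ order_embedding f.

Definition p_morphic_image (Y X : IMFrame) : Prop :=
  exists f : X -> Y, IMF_morphism f /\ (forall y, exists x, f x = y).

Inductive formula : Type :=
| Var of nat
| Bot
| And of formula & formula
| Or of formula & formula
| Imp of formula & formula
| Tri of formula.

Fixpoint truth_set (X : IMFrame) (V : nat -> set X) (phi : formula) : set X :=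
  match phi with
  | Var p => V p
  | Bot => set0
  | And phi psi => truth_set V phi `&` truth_set V psi
  | Or phi psi => truth_set V phi `|` truth_set V psi
  | Imp phi psi =>
      [set x | forall y, fle x y -> truth_set V phi y -> truth_set V psi y]
  | Tri phi => [set x | nbhd x (truth_set V phi)]
  end.

Definition valid (X : IMFrame) (phi : formula) : Prop :=
  forall V : nat -> set X, (forall p, upset fle (V p)) ->
  forall x, truth_set V phi x.

Section DisjointUnion.
Variables (I : Type) (X : I -> IMFrame).

Inductive du_le : {k : I & X k} -> {k : I & X k} -> Prop :=
| DuLe k (x y : X k) : fle x y -> du_le (existT _ k x) (existT _ k y).

Definition du_nbhd (u : {k : I & X k}) : set (set {k : I & X k}) :=
  [set a | upset du_le a /\
           nbhd (projT2 u) [set x | a (existT _ (projT1 u) x)]].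

Lemma du_le_inv u v : du_le u v ->
  exists2 y, v = existT _ (projT1 u) y & fle (projT2 u) y.
Proof. by case=> k x y xy; exists y. Qed.

Lemma existT_inj k (x y : X k) :
  existT (fun k => X k) k x = existT (fun k => X k) k y -> x = y.
Proof.
move=> E.
have H u v : u = v -> exists e : projT1 u = projT1 v,
    eq_rect _ (fun k => X k) (projT2 u) _ e = projT2 v.
  by move=> ->; exists erefl.
by case: (H _ _ E) => /= e; rewrite (Prop_irrelevance e erefl).
Qed.

Lemma du_leE k (x y : X k) : du_le (existT _ k x) (existT _ k y) -> fle x y.
Proof. by move=> /du_le_inv[z /existT_inj ->]. Qed.

Lemma du_le_order : Relation_Definitions.order _ du_le.
Proof.
split.
- by case=> k x; constructor; case: (fle_order (X k)) => + _ _; apply.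
- move=> [k x] v w /du_le_inv[y -> /= xy] /du_le_inv[z -> /= yz].
  by constructor; case: (fle_order (X k)) => _ + _; apply; [apply: xy|].
- move=> [k x] v /du_le_inv[y -> /= xy] /du_leE yx.
  by congr existT; case: (fle_order (X k)) => _ _; apply.
Qed.

Lemma du_slice_upset k (a : set {k : I & X k}) :
  upset du_le a -> upset fle [set x : X k | a (existT _ k x)].
Proof. by move=> aU x y xy; apply: aU; constructor. Qed.

Lemma du_nbhd_upset u a : du_nbhd u a -> upset du_le a.
Proof. by case. Qed.

Lemma du_nbhd_up u a b :
  du_nbhd u a -> upset du_le b -> a `<=` b -> du_nbhd u b.
Proof.
move=> [aU ua] bU ab; split=> //; apply: nbhd_up ua _ _.
  exact: du_slice_upset.
by move=> x; apply: ab.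
Qed.

Lemma du_nbhd_le u v : du_le u v -> du_nbhd u `<=` du_nbhd v.
Proof. by case=> k x y xy a [aU ua]; split=> //; apply: nbhd_le xy _ ua. Qed.

Definition disjoint_union : IMFrame :=
  MkIMFrame du_le_order du_nbhd_upset du_nbhd_up du_nbhd_le.

End DisjointUnion.

Section PrimeFilterExtension.
Variable X : IMFrame.

(* Prime filters of the lattice of upsets of [X], as sets of subsets of [X]. *)
Record prime_filter (q : set (set X)) : Prop := MkPrimeFilter {
  pf_upset : forall a, q a -> upset fle a;
  pf_top : q setT;
  pf_meet : forall a b, q a -> q b -> q (a `&` b);
  pf_up : forall a b, q a -> upset fle b -> a `<=` b -> q b;
  pf_proper : ~ q set0;
  pf_prime : forall a b, upset fle a -> upset fle b ->
    q (a `|` b) -> q a \/ q b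
}.

Definition pe_point : Type := {q : set (set X) | prime_filter q}.

Definition pe_le (p q : pe_point) : Prop := proj1_sig p `<=` proj1_sig q.

Definition theta (a : set X) : set pe_point := [set q | proj1_sig q a].

Definition tri (a : set X) : set X := [set x | nbhd x a].

Definition pe_open (D : set pe_point) : Prop :=
  D = \bigcup_(a in [set a | upset fle a /\ theta a `<=` D]) theta a.

Definition sigma_open (q : pe_point) (D : set pe_point) : Prop :=
  exists a : set X, [/\ upset fle a, proj1_sig q (tri a) & theta a `<=` D].

Definition sigma_nbhd (q : pe_point) : set (set pe_point) :=
  [set D | upset pe_le D /\
    ((pe_open D /\ sigma_open q D) \/
     (~ pe_open D /\
      forall O, upset pe_le O -> pe_open O -> D `<=` O -> sigma_open q O))].

Lemma pe_le_order : Relation_Definitions.order _ pe_le.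
Proof.
split.
- by move=> p a.
- by move=> p q r pq qr a /pq/qr.
- move=> [p pP] [q qP] /= pq qp.
  have E : p = q by apply/seteqP; split.
  by rewrite -{}E in qP pq qp *; rewrite (Prop_irrelevance pP qP).
Qed.

Lemma sigma_nbhd_upset q D : sigma_nbhd q D -> upset pe_le D.
Proof. by case. Qed.

Lemma sigma_openS q D E : D `<=` E -> sigma_open q D -> sigma_open q E.
Proof. by move=> DE [a [aU qa aD]]; exists a; split=> // r /aD/DE. Qed.

Lemma sigma_nbhd_up q D E :
  sigma_nbhd q D -> upset pe_le E -> D `<=` E -> sigma_nbhd q E.
Proof.
move=> [_ qD] EU DE; split=> //.
case: (pselect (pe_open E)) => EO; [left|right]; split=> //.
  by case: qD => -[_ qD]; [apply: sigma_openS DE qD | apply: qD].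
move=> O OU OO EO'; have DO : D `<=` O by move=> x /DE/EO'.
by case: qD => -[_ qD]; [apply: sigma_openS DO qD | apply: qD].
Qed.

Lemma sigma_nbhd_le p q : pe_le p q -> sigma_nbhd p `<=` sigma_nbhd q.
Proof.
move=> pq D [DU pD]; split=> //.
have mono E : sigma_open p E -> sigma_open q E.
  by move=> [a [aU pa aE]]; exists a; split=> //; apply: pq.
case: pD => -[DO pD]; [left|right]; split=> //; first exact: mono.
by move=> O OU OO DO'; apply/mono/pD.
Qed.

Definition sigma_pe : IMFrame :=
  MkIMFrame pe_le_order sigma_nbhd_upset sigma_nbhd_up sigma_nbhd_le.

End PrimeFilterExtension.

(* A class of frames is [IMFrame -> Prop] and not [set IMFrame]: the universe
   of [set] is that of the carriers, in which [IMFrame] does not fit. *)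
Definition axiomatic (K : IMFrame -> Prop) : Prop :=
  exists Gamma : set formula,
    forall X, K X <-> (forall phi, Gamma phi -> valid X phi).

Definition closed_under_sigma_pe (K : IMFrame -> Prop) : Prop :=
  forall X, K X -> K (sigma_pe X).

Definition reflects_sigma_pe (K : IMFrame -> Prop) : Prop :=
  forall X, K (sigma_pe X) -> K X.

(* Families are indexed by an arbitrary, possibly empty, type. *)
Definition closed_under_disjoint_unions (K : IMFrame -> Prop) : Prop :=
  forall (I : Type) (X : I -> IMFrame),
    (forall k, K (X k)) -> K (disjoint_union X).

Definition closed_under_generated_subframes (K : IMFrame -> Prop) : Prop :=
  forall X Y, generated_subframe X Y -> K Y -> K X.

Definition closed_under_p_morphic_images (K : IMFrame -> Prop) : Prop :=
  forall X Y, p_morphic_image Y X -> K X -> K Y.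

(* Main.v *)
Require Import Defs.
From Stdlib Require Relation_Definitions.
From mathcomp Require Import all_boot.
From mathcomp Require Import boolp classical_sets filter.

Set Implicit Arguments.
Unset Strict Implicit.
Unset Printing Implicit Defensive.

Local Open Scope classical_set_scope.

(** Axiomatic classes have the closure properties because truth sets are
    preserved by preimages along IMF-morphisms, and by [theta].

    Conversely, let [X] validate the logic of [K]. Consider formulas whose
    propositional letters are the upsets of [X], choose for each of them that
    fails in [K] a refuting model based on a frame of [K], and let [Y] be the
    disjoint union of these. The truth sets in [Y] form a subalgebra of the
    complex algebra of [Y], and mapping the truth set in [Y] of a formula to
    its truth set in [X] is a well defined homomorphism of this subalgebra
    onto the complex algebra of [X]. Dually, the frame of prime filters of the
    subalgebra is a p-morphic image of [sigma_pe Y], and [sigma_pe X] is a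
    generated subframe of it. *)

(** * Preservation of truth *)

Lemma fle_refl (X : IMFrame) (x : X) : fle x x.
Proof. by case: (fle_order X). Qed.

Lemma fle_trans (X : IMFrame) (x y z : X) : fle x y -> fle y z -> fle x z.
Proof. by case: (fle_order X) => _ + _; apply. Qed.

Lemma upset_setI (X : IMFrame) (a b : set X) :
  upset fle a -> upset fle b -> upset fle (a `&` b).
Proof. by move=> aU bU x y xy [/(aU _ _ xy) ay /(bU _ _ xy)]. Qed.

Lemma upset_setU (X : IMFrame) (a b : set X) :
  upset fle a -> upset fle b -> upset fle (a `|` b).
Proof.
by move=> aU bU x y xy [/(aU _ _ xy)|/(bU _ _ xy)]; [left|right].
Qed.

Lemma upset_tri (X : IMFrame) (a : set X) : upset fle (tri a).
Proof. by move=> x y /nbhd_le; apply. Qed.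

Lemma tri_mono (X : IMFrame) (a b : set X) :
  upset fle b -> a `<=` b -> tri a `<=` tri b.
Proof. by move=> bU ab x xa; apply: nbhd_up xa bU ab. Qed.

Lemma upset_truth_set (X : IMFrame) (V : nat -> set X) phi :
  (forall p, upset fle (V p)) -> upset fle (truth_set V phi).
Proof.
move=> VU; elim: phi => [p||phi IH psi IH'|phi IH psi IH'|phi IH psi IH'|phi _] /=.
- exact: VU.
- by [].
- exact: upset_setI.
- exact: upset_setU.
- by move=> x y xy H z yz; apply: H; apply: fle_trans xy yz.
- exact: upset_tri.
Qed.

Lemma upset_preimage (X Y : IMFrame) (f : X -> Y) (a : set Y) :
  IMF_morphism f -> upset fle a -> upset fle (f @^-1` a).
Proof. by move=> [[fM _] _] aU x y /fM; apply: aU. Qed.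

Lemma truth_set_preimage (X Y : IMFrame) (f : X -> Y) (V : nat -> set Y) phi :
  IMF_morphism f -> (forall p, upset fle (V p)) ->
  truth_set (fun p => f @^-1` V p) phi = f @^-1` truth_set V phi.
Proof.
move=> fM VU; have [[f_le f_back] f_nbhd] := fM.
elim: phi => [p||phi IH psi IH'|phi IH psi IH'|phi IH psi IH'|phi IH] //=.
- by rewrite IH IH'.
- by rewrite IH IH'.
- rewrite IH IH'; apply/seteqP; split=> x /= H y xy.
    by have [z [xz <-]] := f_back _ _ xy; apply: H.
  by apply/H/f_le.
- rewrite IH; apply/seteqP; split=> x /=;
    by rewrite f_nbhd //; exact: upset_truth_set.
Qed.

Lemma du_inclusion_morphism (I : Type) (X : I -> IMFrame) (k : I) :
  @IMF_morphism (X k) (disjoint_union X) (fun x => existT (fun k => X k) k x).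
Proof.
split; first split.
- by move=> x y xy; constructor.
- by move=> x _ /du_le_inv[y -> /= xy]; exists y.
- by move=> x a aU; split=> [xa|[]].
Qed.

Lemma valid_disjoint_union (I : Type) (X : I -> IMFrame) phi :
  (forall k, valid (X k) phi) -> valid (disjoint_union X) phi.
Proof.
move=> H V VU [k x]; have iM := du_inclusion_morphism X k.
pose f (y : X k) : disjoint_union X := existT (fun k => X k) k y.
change ((f @^-1` truth_set V phi) x).
by rewrite -truth_set_preimage //; apply: H => p; exact: upset_preimage.
Qed.

Lemma valid_p_morphic_image (X Y : IMFrame) phi :
  p_morphic_image Y X -> valid X phi -> valid Y phi.
Proof.
move=> [f [fM f_surj]] H V VU y; have [x <-] := f_surj y.
suff : (f @^-1` truth_set V phi) x by [].
by rewrite -truth_set_preimage //; apply: H => p; exact: upset_preimage.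
Qed.

Lemma valid_generated_subframe (X Y : IMFrame) phi :
  generated_subframe X Y -> valid Y phi -> valid X phi.
Proof.
move=> [f [fM f_emb]] H V VU x.
(* [W p] is the upset of [Y] generated by the image of [V p]. As [f] reflects the order and [V p] is
   an upset, its preimage is again [V p]. *)
pose W p : set Y := [set y | exists2 x, V p x & fle (f x) y].
have WU p : upset fle (W p).
  by move=> y z yz [x' Vx' xy]; exists x' => //; apply: fle_trans xy yz.
have -> : V = fun p => f @^-1` W p.
  apply/funext => p; apply/seteqP; split=> z /=.
    by move=> Vz; exists z => //; apply: fle_refl.
  by move=> [x' Vx' /f_emb xz]; apply: VU xz Vx'.
by rewrite truth_set_preimage //; apply: H.
Qed.

(** * Prime filter extensions *)

(* An ultrafilter containing the sets [a `\` b], for [a] in [F] and [b] in [J],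
   restricts to a prime filter of upsets. *)
Lemma prime_filter_separation (X : IMFrame) (F J : set (set X)) :
  F !=set0 -> (forall a, F a -> upset fle a) ->
  (forall a b, F a -> F b -> F (a `&` b)) ->
  J !=set0 -> (forall a b, J a -> J b -> J (a `|` b)) ->
  (forall a b, F a -> J b -> ~ a `<=` b) ->
  exists q : pe_point X,
    (forall a, F a -> theta a q) /\ (forall b, J b -> ~ theta b q).
Proof.
move=> [a0 Fa0] FU FI [b0 Jb0] JU FJ.
pose G : set_system X :=
  [set S | exists a b, [/\ F a, J b & a `\` b `<=` S]].
have GP : ProperFilter G.
  split.
    move=> [a [b [Fa Jb ab]]]; apply: (FJ a b) => // x ax.
    by apply: contrapT => nbx; apply: (ab x).
  split.
  - by exists a0, b0; split.
  - move=> S T [a [b [Fa Jb abS]]] [a' [b' [Fa' Jb' abT]]].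
    exists (a `&` a'), (b `|` b'); split; [exact: FI|exact: JU|].
    move=> x [[ax a'x] /not_orP[nbx nb'x]]; split; first exact: abS.
    exact: abT.
  - move=> S T ST [a [b [Fa Jb abS]]]; exists a, b; split=> //.
    by move=> x /abS/ST.
have [U [UU GU]] := ultraFilterLemma GP.
have [[U0 UF] _] := UU.
have qP : prime_filter [set a | upset (@fle X) a /\ U a].
  split=> /=.
  - by move=> a [].
  - by split=> //; apply: filterT.
  - move=> a b [aU Ua] [bU Ub].
    by split; [exact: upset_setI|exact: filterI].
  - by move=> a b [_ Ua] bU ab; split=> //; apply: filterS Ua.
  - by move=> [_ /U0].
  - move=> a b aU bU [_ Uab].
    have [Ua|Uca] := in_ultra_setVsetC a UU; first by left.
    right; split=> //; apply: filterS (filterI Uab Uca).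
    by move=> x [[]].
exists (exist _ _ qP); split=> /=.
- move=> a Fa; split; first exact: FU.
  by apply: GU; exists a, b0; split=> // x [].
- move=> b Jb [_ Ub]; apply: U0.
  have Uc : U (~` b) by apply: GU; exists a0, b; split=> // x [].
  by apply: filterS (filterI Ub Uc) => x [].
Qed.

Lemma principal_filter_prime (X : IMFrame) (x : X) :
  prime_filter [set a : set X | upset fle a /\ a x].
Proof.
split=> /=.
- by move=> a [].
- by [].
- by move=> a b [aU ax] [bU bx]; split=> //; exact: upset_setI.
- by move=> a b [_ ax] bU ab; split=> //; exact: ab.
- by case.
- by move=> a b aU bU [_ [ax|bx]]; [left|right].
Qed.

Definition principal_filter (X : IMFrame) (x : X) : sigma_pe X :=
  exist _ _ (principal_filter_prime x).

Lemma theta_sub (X : IMFrame) (a b : set X) :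
  upset fle a -> theta a `<=` theta b -> a `<=` b.
Proof.
move=> aU ab x ax.
by have [] : theta b (principal_filter x) by apply: ab.
Qed.

Lemma upset_theta (X : IMFrame) (a : set X) : upset (@pe_le X) (theta a).
Proof. by move=> p q pq; apply: pq. Qed.

Lemma pe_openP (X : IMFrame) (D : set (pe_point X)) :
  pe_open D <->
  forall q, D q -> exists a, [/\ upset fle a, theta a q & theta a `<=` D].
Proof.
split=> [-> q [a [aU aD] qa]|H].
  by exists a; split=> // r ra; exists a.
apply/seteqP; split=> [q /H[a [aU qa aD]]|q [a [_ aD] /aD//]].
by exists a.
Qed.

Lemma pe_open_theta (X : IMFrame) (a : set X) :
  upset fle a -> pe_open (theta a).
Proof. by move=> aU; apply/pe_openP => q qa; exists a; split. Qed.

(* For open [D] the two clauses of [sigma_nbhd] agree. *)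
Lemma sigma_nbhdE (X : IMFrame) (q : pe_point X) (D : set (pe_point X)) :
  sigma_nbhd q D <->
  upset (@pe_le X) D /\
  forall O, upset (@pe_le X) O -> pe_open O -> D `<=` O -> sigma_open q O.
Proof.
split=> [[DU [[_ qD]|[_ H]]]|[DU H]]; split=> //.
  by move=> O _ _ DO; apply: sigma_openS DO qD.
have [DO|nDO] := pselect (pe_open D); last by right.
by left; split=> //; apply: H.
Qed.

(** As [theta a] is open, it is its own smallest open superset. A witness [b] for it satisfies [b]
    included in [a], by testing on principal filters, and [tri] is monotone. *)
Lemma sigma_nbhd_theta (X : IMFrame) (q : pe_point X) (a : set X) :
  upset fle a -> sigma_nbhd q (theta a) <-> theta (tri a) q.
Proof.
move=> aU; rewrite sigma_nbhdE; split=> [[_ H]|qa]; last first.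
  by split=> [|O _ _ aO]; [exact: upset_theta|exists a].
have [|||b [bU qb ba]] := H (theta a) => //.
- exact: upset_theta.
- exact: pe_open_theta.
apply: (pf_up (proj2_sig q) qb (@upset_tri _ a)).
exact: tri_mono (theta_sub bU ba).
Qed.

(** [theta] is a homomorphism of complex algebras. Only implication needs new prime filters; [Tri]
    is [sigma_nbhd_theta]. *)
Lemma truth_set_theta (X : IMFrame) (V : nat -> set X) phi :
  (forall p, upset fle (V p)) ->
  @truth_set (sigma_pe X) (fun p => theta (V p)) phi = theta (truth_set V phi).
Proof.
move=> VU; have TU psi := @upset_truth_set X V psi VU.
elim: phi => [p||phi IH psi IH'|phi IH psi IH'|phi IH psi IH'|phi IH] //=.
- by apply/seteqP; split=> // q /(pf_proper (proj2_sig q)).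
- rewrite IH IH'; apply/seteqP; split=> q; have qP := proj2_sig q.
    by case; apply: pf_meet.
  by move=> H; split; apply: (pf_up qP H) => // x [].
- rewrite IH IH'; apply/seteqP; split=> q; have qP := proj2_sig q.
    case=> H; apply: (pf_up qP H); try exact: upset_setU.
      by left.
    by right.
  by move=> H; exact: (pf_prime qP (TU _) (TU _) H).
- rewrite IH IH'; apply/seteqP; split=> q; have qP := proj2_sig q; last first.
    move=> H r qr ra; have rP := proj2_sig r.
    apply: (pf_up rP (pf_meet rP (qr _ H) ra)) => // x [Hx ax].
    by apply: Hx => //; apply: fle_refl.
  move=> H; apply: contrapT => nq.
  (* A prime filter extending [q], containing the truth set of [phi] and avoiding that of [psi]
     would contradict [H]. It exists: if [c] in [q] meets the truth set of [phi] inside that of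
     [psi], then [c] lies in the truth set of the implication, against [nq]. *)
  pose F := [set c `&` truth_set V phi | c in proj1_sig q].
  have [|||||_ _ [c qc <-] -> cab|r [Fr Jr]] :=
    @prime_filter_separation X F [set truth_set V psi].
  + by exists (setT `&` truth_set V phi), setT => //; exact: pf_top.
  + move=> _ [c qc <-]; apply: upset_setI => //; exact: (pf_upset qP).
  + move=> _ _ [c qc <-] [d qd <-]; exists (c `&` d); first exact: pf_meet.
    by rewrite -setIIl.
  + by exists (truth_set V psi).
  + by move=> _ _ -> ->; exact: setUid.
  + apply: nq; apply: (pf_up qP qc); first exact: (TU (Imp phi psi)).
    move=> x cx y xy ay; apply: cab; split=> //.
    exact: (pf_upset qP qc) xy cx.
  + have rP := proj2_sig r; apply: (Jr (truth_set V psi)) => //; apply: H.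
      move=> c qc; apply: (pf_up rP (Fr _ _)); first by exists c.
        exact: (pf_upset qP).
      by move=> x [].
    by apply: (pf_up rP (Fr _ (imageP _ (pf_top qP)))) => // x [].
- by rewrite IH; apply/seteqP; split=> q; have [] := sigma_nbhd_theta q (TU phi).
Qed.

Lemma valid_sigma_pe (X : IMFrame) phi : valid (sigma_pe X) phi -> valid X phi.
Proof.
move=> H V VU x.
have := H (fun p => theta (V p)) (fun p => @upset_theta X _) (principal_filter x).
by rewrite truth_set_theta // => -[].
Qed.

(** * Formulas over an arbitrary type of letters *)

Inductive gformula (P : Type) : Type :=
| GVar of P
| GBot
| GAnd of gformula P & gformula P
| GOr of gformula P & gformula P
| GImp of gformula P & gformula P
| GTri of gformula P.

Arguments GBot {P}.

Definition gtop (P : Type) : gformula P := GImp GBot GBot.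

Fixpoint gtruth (P : Type) (X : IMFrame) (V : P -> set X) (phi : gformula P) :
    set X :=
  match phi with
  | GVar p => V p
  | GBot => set0
  | GAnd phi psi => gtruth V phi `&` gtruth V psi
  | GOr phi psi => gtruth V phi `|` gtruth V psi
  | GImp phi psi =>
      [set x | forall y, fle x y -> gtruth V phi y -> gtruth V psi y]
  | GTri phi => tri (gtruth V phi)
  end.

(** The alias [{classic P}] carries the decidable equality that [index] requires. *)
Fixpoint gvars (P : Type) (phi : gformula P) : seq {classic P} :=
  match phi with
  | GVar p => [:: p : {classic P}]
  | GBot => [::]
  | GAnd phi psi | GOr phi psi | GImp phi psi => gvars phi ++ gvars psi
  | GTri phi => gvars phi
  end.

Fixpoint rename (P : Type) (e : P -> nat) (phi : gformula P) : formula :=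
  match phi with
  | GVar p => Var (e p)
  | GBot => Bot
  | GAnd phi psi => And (rename e phi) (rename e psi)
  | GOr phi psi => Or (rename e phi) (rename e psi)
  | GImp phi psi => Imp (rename e phi) (rename e psi)
  | GTri phi => Tri (rename e phi)
  end.

Lemma truth_set_rename (P : Type) (X : IMFrame) (e : P -> nat)
    (V : nat -> set X) phi :
  truth_set V (rename e phi) = gtruth (V \o e) phi.
Proof.
by elim: phi => [p||phi IH psi IH'|phi IH psi IH'|phi IH psi IH'|phi IH] //=;
  rewrite IH ?IH'.
Qed.

Lemma eq_gtruth (P : Type) (X : IMFrame) (V W : P -> set X) phi :
  {in gvars phi, forall p, V p = W p} -> gtruth V phi = gtruth W phi.
Proof.
elim: phi => [p||phi IH psi IH'|phi IH psi IH'|phi IH psi IH'|phi IH] //= VW;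
  try by rewrite IH ?IH' // => p pin; apply: VW; rewrite mem_cat pin ?orbT.
by apply: VW; rewrite mem_head.
Qed.

(** A formula has finitely many letters, so their positions in [gvars phi] can serve as letters of
    the original language. *)
Definition numbering (P : Type) (phi : gformula P) : P -> nat :=
  fun p => index (p : {classic P}) (gvars phi).

(** Numbers past the end of the list receive [set0], which is an upset. *)
Definition numbered_valuation (P : Type) (phi : gformula P) (X : IMFrame)
    (V : P -> set X) : nat -> set X :=
  fun n => nth set0 (map V (gvars phi)) n.

Lemma gtruthE (P : Type) (X : IMFrame) (V : P -> set X) phi :
  gtruth V phi =
  truth_set (numbered_valuation phi V) (rename (numbering phi) phi).
Proof.
rewrite truth_set_rename; apply: eq_gtruth => p pin.
rewrite /numbered_valuation /numbering /= (nth_map p) ?index_mem //.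
by rewrite nth_index.
Qed.

Lemma upset_numbered_valuation (P : Type) (phi : gformula P) (X : IMFrame)
    (V : P -> set X) :
  (forall p, upset fle (V p)) ->
  forall n, upset fle (numbered_valuation phi V n).
Proof.
move=> VU n; rewrite /numbered_valuation; elim: (gvars phi) n => [|p s IH] [|n] //=.
Qed.

Lemma upset_gtruth (P : Type) (X : IMFrame) (V : P -> set X) phi :
  (forall p, upset fle (V p)) -> upset fle (gtruth V phi).
Proof.
by move=> VU; rewrite gtruthE; apply/upset_truth_set/upset_numbered_valuation.
Qed.

Lemma gtruth_preimage (P : Type) (X Y : IMFrame) (f : X -> Y) (V : P -> set Y)
    phi :
  IMF_morphism f -> (forall p, upset fle (V p)) ->
  gtruth (fun p => f @^-1` V p) phi = f @^-1` gtruth V phi.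
Proof.
move=> fM VU; rewrite !gtruthE -truth_set_preimage //; last first.
  exact: upset_numbered_valuation.
congr truth_set; apply/funext => n; rewrite /numbered_valuation.
by elim: (gvars phi) n => [|p s IH] [|n] //=.
Qed.

Definition gvalid (P : Type) (X : IMFrame) (phi : gformula P) : Prop :=
  forall V : P -> set X, (forall p, upset fle (V p)) ->
  forall x, gtruth V phi x.

Lemma gvalidE (P : Type) (X : IMFrame) (phi : gformula P) :
  gvalid X phi <-> valid X (rename (numbering phi) phi).
Proof.
split=> H V VU x.
  by rewrite truth_set_rename; apply: H => p; exact: VU.
by rewrite gtruthE; apply: H; exact: upset_numbered_valuation.
Qed.

(** * The frame of prime theories of a model *)

Section PrimeTheories.
Variables (P : Type) (Y : IMFrame) (V : P -> set Y).

(* Prime filters of the algebra of truth sets of [V], as sets of formulas. *)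
Record prime_theory (t : set (gformula P)) : Prop := MkPrimeTheory {
  pt_top : t (gtop P);
  pt_up : forall phi psi, t phi -> gtruth V phi `<=` gtruth V psi -> t psi;
  pt_and : forall phi psi, t phi -> t psi -> t (GAnd phi psi);
  pt_bot : ~ t GBot;
  pt_or : forall phi psi, t (GOr phi psi) -> t phi \/ t psi
}.

Definition theory : Type := {t : set (gformula P) | prime_theory t}.

Definition theory_le (s t : theory) : Prop := proj1_sig s `<=` proj1_sig t.

Definition ext (phi : gformula P) : set theory := [set t | proj1_sig t phi].

Definition theory_open (O : set theory) : Prop :=
  forall t, O t -> exists2 phi, ext phi t & ext phi `<=` O.

(** This is the characterization [sigma_nbhdE] with the truth sets of formulas in place of all
    upsets. *)
Definition theory_nbhd (t : theory) : set (set theory) :=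
  [set D | upset theory_le D /\ forall O, theory_open O -> D `<=` O ->
    exists2 phi, ext (GTri phi) t & ext phi `<=` O].

Lemma theory_le_order : Relation_Definitions.order _ theory_le.
Proof.
split.
- by move=> s phi.
- by move=> s t u st tu phi /st/tu.
- move=> [s sP] [t tP] /= st ts.
  have E : s = t by apply/seteqP; split.
  by rewrite -{}E in tP st ts *; rewrite (Prop_irrelevance sP tP).
Qed.

Lemma theory_nbhd_upset t D : theory_nbhd t D -> upset theory_le D.
Proof. by case. Qed.

Lemma theory_nbhd_up t D E :
  theory_nbhd t D -> upset theory_le E -> D `<=` E -> theory_nbhd t E.
Proof.
move=> [_ tD] EU DE; split=> // O OO EO.
by apply: tD => // u /DE/EO.
Qed.

Lemma theory_nbhd_le s t : theory_le s t -> theory_nbhd s `<=` theory_nbhd t.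
Proof.
move=> st D [DU sD]; split=> // O OO DO.
by have [phi sphi phiO] := sD O OO DO; exists phi => //; apply: st.
Qed.

Definition theory_frame : IMFrame :=
  MkIMFrame theory_le_order theory_nbhd_upset theory_nbhd_up theory_nbhd_le.

(* The map dual to the homomorphism taking the truth set of a formula under [V]
   to its truth set under [W], which exists by [VW]. *)
Variables (Z : IMFrame) (W : P -> set Z).
Hypothesis WU : forall p, upset fle (W p).
Hypothesis VW : forall phi psi,
  gtruth V phi `<=` gtruth V psi -> gtruth W phi `<=` gtruth W psi.

Let gU phi : upset fle (gtruth W phi) := upset_gtruth (phi := phi) WU.

Lemma gtruth_top : gtruth W (gtop P) = setT.
Proof. by apply/seteqP; split=> // x _ y _. Qed.

Lemma theory_of_prime (q : pe_point Z) :
  prime_theory [set phi | proj1_sig q (gtruth W phi)].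
Proof.
have qP := proj2_sig q; split=> /=.
- by have := pf_top qP; rewrite -gtruth_top.
- by move=> phi psi qphi /VW; apply: (pf_up qP).
- by move=> phi psi; apply: (pf_meet qP).
- exact: pf_proper.
- by move=> phi psi; apply: (pf_prime qP).
Qed.

Definition theory_of (q : sigma_pe Z) : theory_frame :=
  exist _ _ (theory_of_prime q).

(** The required [r] contains [q] and the truth sets of [t] and avoids those of formulas outside
    [t]. Separation applies because an inclusion of [a] met with [phi] in [psi], for [a] in [q],
    puts [GImp phi psi] into the theory of [q], hence into [t]. *)
Lemma theory_of_back (q : sigma_pe Z) (t : theory_frame) :
  fle (theory_of q) t -> exists r, fle q r /\ theory_of r = t.
Proof.
move=> qt; have qP := proj2_sig q; have tP := proj2_sig t.
pose F := [set S | exists a phi,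
  [/\ proj1_sig q a, proj1_sig t phi & S = a `&` gtruth W phi]].
pose J := [set gtruth W psi | psi in ~` proj1_sig t].
have [||||||r [Fr Jr]] := @prime_filter_separation Z F J.
- exists (setT `&` gtruth W (gtop P)), setT, (gtop P).
  by split=> //; [exact: pf_top|exact: pt_top].
- move=> _ [a [phi [qa _ ->]]]; apply: upset_setI (@gU phi).
  exact: (pf_upset qP).
- move=> _ _ [a [phi [qa tphi ->]]] [b [psi [qb tpsi ->]]].
  exists (a `&` b), (GAnd phi psi); split.
  + exact: pf_meet.
  + exact: pt_and.
  + by rewrite /= setIACA.
- by exists (gtruth W GBot), GBot => //; exact: pt_bot.
- move=> _ _ [phi nphi <-] [psi npsi <-]; exists (GOr phi psi) => //.
  by move=> /(pt_or tP)[].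
- move=> _ _ [a [phi [qa tphi ->]]] [psi npsi <-] sub; apply: npsi.
  have timp : proj1_sig t (GImp phi psi).
    apply: qt; apply: (pf_up qP qa); first exact: (@gU (GImp phi psi)).
    move=> x ax y xy phiy; apply: sub; split=> //.
    exact: (pf_upset qP qa) xy ax.
  apply: (pt_up tP (pt_and tP tphi timp)) => y [phiy]; apply=> //.
  exact: fle_refl.
exists r; have rP := proj2_sig r; split.
  move=> a qa; apply: (pf_up rP (Fr (a `&` gtruth W (gtop P)) _)).
  + by exists a, (gtop P); split=> //; exact: pt_top.
  + exact: (pf_upset qP).
  + by move=> x [].
case: theory_le_order => _ _; apply=> phi /=.
  move=> rphi; apply: contrapT => nphi.
  by apply: (Jr (gtruth W phi)) => //; exists phi.
move=> tphi; apply: (pf_up rP (Fr (setT `&` gtruth W phi) _)) => //.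
by exists setT, phi; split=> //; exact: pf_top.
Qed.

Lemma theory_of_open (O : set theory) :
  theory_open O -> pe_open (theory_of @^-1` O).
Proof.
move=> OO; apply/pe_openP => q /OO[phi qphi phiO].
by exists (gtruth W phi); split=> // r rphi; apply: phiO.
Qed.

Lemma theory_open_upset (O : set theory) : theory_open O -> upset theory_le O.
Proof. by move=> OO s t st /OO[phi /st tphi]; apply. Qed.

(** Compactness of [theta b]: the truth sets of formulas with [ext phi] inside [O] are closed under
    unions, so if none contains [b], some prime filter contains [b] and avoids them all. Its theory
    would lie in [O], which is open. *)
Lemma theory_of_compact (b : set Z) (O : set theory) :
  theory_open O -> upset fle b -> theta b `<=` theory_of @^-1` O ->
  exists2 phi, ext phi `<=` O & b `<=` gtruth W phi.
Proof.
move=> OO bU bO; apply: contrapT => nex.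
have [||||||r [Fr Jr]] := @prime_filter_separation Z [set b]
  [set gtruth W phi | phi in [set phi | ext phi `<=` O]].
- by exists b.
- by move=> _ ->.
- by move=> _ _ -> ->; exact: setIid.
- by exists (gtruth W GBot), GBot => //= t /(pt_bot (proj2_sig t)).
- move=> _ _ [phi phiO <-] [psi psiO <-]; exists (GOr phi psi) => //= t.
  by case/(pt_or (proj2_sig t)); [apply: phiO|apply: psiO].
- by move=> _ _ -> [phi phiO <-] bphi; apply: nex; exists phi.
have /OO[phi rphi phiO] : O (theory_of r) by apply/bO/Fr.
by apply: (Jr (gtruth W phi)) => //; exists phi.
Qed.

(* [E] is the largest open set whose preimage is included in [O]. *)
Lemma theory_of_shrink (D : set theory) (O : set (pe_point Z)) :
  upset theory_le D -> pe_open O -> theory_of @^-1` D `<=` O ->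
  exists E, [/\ theory_open E, D `<=` E & theory_of @^-1` E `<=` O].
Proof.
move=> DU /pe_openP OO DO.
exists [set t | exists2 phi, ext phi t & theta (gtruth W phi) `<=` O].
split=> [t [phi tphi phiO]|t Dt|q [phi qphi]]; last exact.
  by exists phi => // s sphi; exists phi.
(* If [t] were outside [E], some [r] would contain the truth sets of [t] and no [a] with [theta a]
   inside [O]. Its theory lies above [t], hence in [D], so [r] would lie in [O], which is open. *)
have tP := proj2_sig t; apply: contrapT => nex.
have [||||||r [Fr Jr]] := @prime_filter_separation Z
  [set gtruth W phi | phi in proj1_sig t] [set a | upset fle a /\ theta a `<=` O].
- by exists (gtruth W (gtop P)), (gtop P) => //; exact: pt_top.
- by move=> _ [phi _ <-].
- move=> _ _ [phi tphi <-] [psi tpsi <-]; exists (GAnd phi psi) => //.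
  exact: pt_and.
- by exists set0; split=> // q /(pf_proper (proj2_sig q)).
- move=> a b [aU aO] [bU bO]; split; first exact: upset_setU.
  by move=> q /(pf_prime (proj2_sig q) aU bU)[/aO|/bO].
- move=> _ b [phi tphi <-] [bU bO] phib; apply: nex; exists phi => // q qphi.
  by apply: bO; apply: (pf_up (proj2_sig q) qphi).
have /DO/OO[a [aU ra aO]] : D (theory_of r).
  by apply: DU Dt => phi tphi; apply: Fr; exists phi.
by apply: (Jr a).
Qed.

(** For neighbourhoods, compactness replaces a witnessing upset by a truth set in one direction; in
    the other, shrinking replaces an open set of prime filters by the preimage of an open set of
    theories. *)
Lemma theory_of_morphism : IMF_morphism theory_of.
Proof.
split; first split.
- by move=> q r qr phi; apply: qr.
- exact: theory_of_back.
move=> q D DU.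
have preU E : upset theory_le E -> upset (@pe_le Z) (theory_of @^-1` E).
  by move=> EU r s rs; apply: EU => phi; apply: rs.
split=> [/sigma_nbhdE[_ H]|[_ H]].
  split=> // O OO DO.
  have [|||b [bU qb bO]] := H (theory_of @^-1` O).
  + by apply: preU; exact: theory_open_upset.
  + exact: theory_of_open.
  + by move=> r /DO.
  have [phi phiO bphi] := theory_of_compact OO bU bO.
  exists phi => //; apply: (pf_up (proj2_sig q) qb); first exact: upset_tri.
  exact: tri_mono bphi.
apply/sigma_nbhdE; split=> [|O _ OO DO]; first exact: preU.
have [E [EO DE EsubO]] := theory_of_shrink DU OO DO.
have [phi qphi phiE] := H E EO DE.
exists (gtruth W phi); split=> // r rphi.
by apply/EsubO/phiE.
Qed.

(** The hypothesis makes the dual homomorphism injective, so the truth sets under [W] of [t] and of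
    its complement can be separated. *)
Lemma theory_of_surjective :
  (forall phi psi,
    gtruth W phi `<=` gtruth W psi -> gtruth V phi `<=` gtruth V psi) ->
  forall t, exists q, theory_of q = t.
Proof.
move=> WV t; have tP := proj2_sig t.
have [||||||r [Fr Jr]] := @prime_filter_separation Z
  [set gtruth W phi | phi in proj1_sig t] [set gtruth W psi | psi in ~` proj1_sig t].
- by exists (gtruth W (gtop P)), (gtop P) => //; exact: pt_top.
- by move=> _ [phi _ <-].
- move=> _ _ [phi tphi <-] [psi tpsi <-]; exists (GAnd phi psi) => //.
  exact: pt_and.
- by exists (gtruth W GBot), GBot => //; exact: pt_bot.
- move=> _ _ [phi nphi <-] [psi npsi <-]; exists (GOr phi psi) => //.
  by move=> /(pt_or tP)[].
- by move=> _ _ [phi tphi <-] [psi npsi <-] /WV/(pt_up tP tphi).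
exists r; case: theory_le_order => _ _; apply=> phi /=; last first.
  by move=> tphi; apply: Fr; exists phi.
move=> rphi; apply: contrapT => nphi.
by apply: (Jr (gtruth W phi)) => //; exists phi.
Qed.

(** The hypothesis makes the dual homomorphism surjective, so a prime filter is determined by its
    theory. *)
Lemma theory_of_embedding :
  (forall a, upset fle a -> exists phi, gtruth W phi = a) ->
  order_embedding theory_of.
Proof.
move=> def q r; split=> [|H a qa].
  by case: theory_of_morphism => -[+ _] _; apply.
have [phi E] := def a (pf_upset (proj2_sig q) qa).
by rewrite -E in qa *; apply: H.
Qed.

End PrimeTheories.

(** * The definability theorem *)

Section Definability.
Variable K : IMFrame -> Prop.
Hypotheses (K_pe : closed_under_sigma_pe K) (K_reflects : reflects_sigma_pe K)
  (K_du : closed_under_disjoint_unions K)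
  (K_sub : closed_under_generated_subframes K)
  (K_img : closed_under_p_morphic_images K).

Lemma generic_model (P : Type) : exists (Y : IMFrame) (V : P -> set Y),
  [/\ K Y, forall p, upset fle (V p) &
      forall phi, (forall y, gtruth V phi y) -> forall Z, K Z -> gvalid Z phi].
Proof.
pose refutes phi (M : {Z : IMFrame & P -> set Z}) :=
  [/\ K (projT1 M), forall p, upset fle (projT2 M p) &
      exists y, ~ gtruth (projT2 M) phi y].
(* Indexing by refutable formulas, with one chosen model each, keeps the family indexed by a type
   although [K] is a class. *)
pose I := {phi | exists M, refutes phi M}.
have [M MP] : {M : I -> {Z : IMFrame & P -> set Z} &
    forall i, refutes (proj1_sig i) (M i)}.
  by apply: (choice (P := fun i M => refutes (proj1_sig i) M)); case.
pose X i := projT1 (M i).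
pose V p : set (disjoint_union X) := [set u | projT2 (M (projT1 u)) p (projT2 u)].
have VU p : upset fle (V p).
  move=> u v /du_le_inv[y -> /=]; case: (MP (projT1 u)) => _ + _; apply.
exists (disjoint_union X), V; split=> //.
  by apply: K_du => i; case: (MP i).
move=> phi phiT Z KZ W WU z; apply: contrapT => nphi.
have ref : exists M, refutes phi M.
  by exists (existT _ Z W); split=> //; exists z.
pose i : I := exist _ phi ref.
have [_ _ [y]] := MP i; apply=> /=.
have := phiT (existT _ i y).
pose f (x : X i) : disjoint_union X := existT (fun k => X k) i x.
(* Truth in the disjoint union restricts to the component that refutes [phi], along its
   inclusion. *)
change ((f @^-1` gtruth V phi) y -> gtruth (fun p => f @^-1` V p) phi y).
by rewrite gtruth_preimage //; exact: du_inclusion_morphism.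
Qed.

Lemma definable_of_closed (X : IMFrame) :
  (forall phi, (forall Y, K Y -> valid Y phi) -> valid X phi) -> K X.
Proof.
move=> XK.
pose P := {a : set X | upset fle a}.
pose W : P -> set X := @proj1_sig _ _.
have WU p : upset fle (W p) by case: p.
have [Y [V [KY VU gen]]] := generic_model P.
have VW phi psi : gtruth V phi `<=` gtruth V psi ->
    gtruth W phi `<=` gtruth W psi.
  move=> sub.
  (* The implication is true throughout the generic model, hence valid in [K], hence in [X] by
     [XK]. *)
  have imp : gvalid X (GImp phi psi).
    apply/gvalidE/XK => Z KZ; apply/gvalidE; apply: gen KZ => y z _.
    exact: sub.
  by move=> x; apply: imp => //; apply: fle_refl.
apply/K_reflects/(K_sub (Y := theory_frame V)).
  exists (theory_of WU VW); split; first exact: theory_of_morphism.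
  apply: theory_of_embedding => a aU.
  by exists (GVar (exist _ a aU)).
apply: (K_img (X := sigma_pe Y)); last exact: K_pe.
(* With [Z := Y] and [W := V] the homomorphism is the inclusion of the subalgebra of truth sets,
   which is injective. *)
have VV phi psi : gtruth V phi `<=` gtruth V psi ->
  gtruth V phi `<=` gtruth V psi by [].
exists (theory_of VU VV); split; first exact: theory_of_morphism.
exact: theory_of_surjective.
Qed.

End Definability.

Theorem theorem4p13 (K : IMFrame -> Prop) (hpe : closed_under_sigma_pe K) :
  axiomatic K <->
    (reflects_sigma_pe K /\
     closed_under_disjoint_unions K /\
     closed_under_generated_subframes K /\
     closed_under_p_morphic_images K).
Proof.
split=> [[Gamma KG]|[Kr [Kdu [Ksub Kimg]]]].
  split; [|split; [|split]].
  - move=> X /KG H; apply/KG => phi /H; exact: valid_sigma_pe.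
  - move=> I X H; apply/KG => phi Gphi; apply: valid_disjoint_union => k.
    by move/KG: (H k); apply.
  - move=> X Y XY /KG H; apply/KG => phi /H; exact: valid_generated_subframe.
  - move=> X Y XY /KG H; apply/KG => phi /H; exact: valid_p_morphic_image.
exists [set phi | forall Y, K Y -> valid Y phi] => X; split.
  by move=> KX phi; apply.
exact: definable_of_closed.
Qed.
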